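(* The labeled Gromov-Hausdorff distance modulo stabilization, $\mathsf{GH}_{st}$, defines a metric on the space of labeled metric spaces (with arbitrary, possibly different, numbers of labels), considered up to stable equivalence. That is, for all labeled metric spaces $\mathcal{X},\mathcal{Y},\mathcal{Z}$: $\mathsf{GH}_{st}(\mathcal{X},\mathcal{Y})\in[0,\infty)$; $\mathsf{GH}_{st}(\mathcal{X},\mathcal{Y})=\mathsf{GH}_{st}(\mathcal{Y},\mathcal{X})$; $\mathsf{GH}_{st}(\mathcal{X},\mathcal{Z})\le\mathsf{GH}_{st}(\mathcal{X},\mathcal{Y})+\mathsf{GH}_{st}(\mathcal{Y},\mathcal{Z})$; and $\mathsf{GH}_{st}(\mathcal{X},\mathcal{Y})=0$ if and only if $\mathcal{X}$ and $\mathcal{Y}$ are stably equivalent.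
   Context: For a positive integer $k$, $[k]:=\{1,\ldots,k\}$. A $k$-labeled metric space is a triple $\mathcal{X}=(X,d_X,L_X)$, where $(X,d_X)$ is a compact metric space and $L_X=(X_1,\ldots,X_k)$ is a finite sequence of nonempty subsets $X_i\subset X$ with $X=\bigcup_{i=1}^k X_i$ (the $X_i$ may overlap). A labeled metric space is a $k$-labeled metric space for some positive integer $k$. For sets $A,B$, $\mathcal{C}(A,B)$ denotes the set of correspondences, i.e. subsets $C\subset A\times B$ whose coordinate projections to $A$ and to $B$ are both surjective. For nonempty $X_1,X_2\subset X$, $Y_1,Y_2\subset Y$, $C_1\in\mathcal{C}(X_1,Y_1)$ and $C_2\in\mathcal{C}(X_2,Y_2)$, define $$\mathrm{dis}(C_1,C_2):=\sup_{(x_1,y_1)\in C_1,\ (x_2,y_2)\in C_2}|d_X(x_1,x_2)-d_Y(y_1,y_2)|.$$ For $q$-labeled metric spaces $\mathcal{X},\mathcal{Y}$, $$\mathsf{GH}_q(\mathcal{X},\mathcal{Y}):=\frac12\inf_{(C_1,\ldots,C_q)}\ \max_{i,j=1,\ldots,q}\mathrm{dis}(C_i,C_j),\qquad C_i\in\mathcal{C}(X_i,Y_i).$$ Let $\mathcal{X}$ be a $k$-labeled metric space and $q\ge k$. A $q$-stabilization of $\mathcal{X}$ is a $q$-labeled metric space $\widehat{\mathcal{X}}=(X,d_X,(\widehat{X}_1,\ldots,\widehat{X}_q))$ such that there is a surjective map $\rho:[q]\to[k]$ with $\widehat{X}_i=X_{\rho(i)}$ for all $i\in[q]$. For labeled metric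 spaces $\mathcal{X},\mathcal{Y}$, $$\mathsf{GH}_{st}(\mathcal{X},\mathcal{Y}):=\inf_{\widehat{\mathcal{X}},\widehat{\mathcal{Y}}}\mathsf{GH}_q(\widehat{\mathcal{X}},\widehat{\mathcal{Y}}),$$ the infimum being over the choice of $q$ and of $q$-stabilizations $\widehat{\mathcal{X}}$ of $\mathcal{X}$ and $\widehat{\mathcal{Y}}$ of $\mathcal{Y}$. Two $q$-labeled metric spaces $\mathcal{X},\mathcal{Y}$ are $q$-isomorphic if there is an isometry (distance-preserving bijection) $\phi:X\to Y$ with $\phi(X_i)=Y_i$ for all $i$. Labeled metric spaces $\mathcal{X},\mathcal{Y}$ are stably equivalent if for some $q$ there exist $q$-stabilizations $\widehat{\mathcal{X}}$, $\widehat{\mathcal{Y}}$ that are $q$-isomorphic.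
   Formalization: The implication from GH_st(X,Y)=0 to stable equivalence is stated only when all labels X_i and Y_j are closed; without closedness it fails, e.g. [0,1] labeled ([0,1],(0,1]) versus ([0,1],[0,1]). *)

(* Defs.v *)
From mathcomp Require Import all_boot all_order all_algebra.
From mathcomp Require Import all_classical all_reals all_analysis.

Set Implicit Arguments.
Unset Strict Implicit.
Unset Printing Implicit Defensive.

Local Open Scope classical_set_scope.
Local Open Scope ring_scope.

(* Labels are indexed by 'I_k = {0, ..., k-1} in place of {1, ..., k}. *)
Record labeling (X : Type) (k : nat) := Labeling {
  label :> 'I_k -> set X ;
  label_pos : (0 < k)%N ;
  label_nonempty : forall i, label i !=set0 ;
  label_cover : \bigcup_i label i = [set: X]
}.

Record labeled_metric_space (R : realType) (k : nat) := LabeledMetricSpace {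
  space : metricType R ;
  space_compact : compact [set: space] ;
  labels : labeling space k
}.

Section GH.
Context {R : realType}.

Definition relabel k q (X : labeled_metric_space R k)
    (L : labeling (space X) q) : labeled_metric_space R q :=
  LabeledMetricSpace (@space_compact R k X) L.

Definition correspondence (X Y : Type) (A : set X) (B : set Y)
    (C : set (X * Y)) : Prop :=
  [/\ C `<=` A `*` B, fst @` C = A & snd @` C = B].

Definition dis (X Y : metricType R) (C1 C2 : set (X * Y)) : \bar R :=
  ereal_sup [set (`|mdist p1.1 p2.1 - mdist p1.2 p2.2|)%:E
            | p1 in C1 & p2 in C2].

(* The unit -oo of the maximum plays no role, since q > 0. *)
Definition GH q (X Y : labeled_metric_space R q) : \bar R :=
  ((2^-1)%:E * ereal_inf
    [set \big[maxe/-oo]_(i < q) \big[maxe/-oo]_(j < q) dis (C i) (C j)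
    | C in [set C : 'I_q -> set (space X * space Y) |
            forall i, correspondence (labels X i) (labels Y i) (C i)]])%E.

Definition stabilization k q (X : labeled_metric_space R k)
    (L : labeling (space X) q) : Prop :=
  (k <= q)%N /\
  exists rho : 'I_q -> 'I_k,
    set_surj [set: 'I_q] [set: 'I_k] rho /\
    forall i, L i = labels X (rho i).

Definition GHst k l (X : labeled_metric_space R k)
    (Y : labeled_metric_space R l) : \bar R :=
  ereal_inf [set z | exists (q : nat)
      (LX : labeling (space X) q) (LY : labeling (space Y) q),
    [/\ stabilization LX, stabilization LY &
        z = GH (relabel LX) (relabel LY)]].

Definition isomorphic q (X Y : labeled_metric_space R q) : Prop :=
  exists phi : space X -> space Y,
    [/\ bijective phi,
        forall x x', mdist (phi x) (phi x') = mdist x x' &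
        forall i, phi @` labels X i = labels Y i].

Definition stably_equivalent k l (X : labeled_metric_space R k)
    (Y : labeled_metric_space R l) : Prop :=
  exists (q : nat) (LX : labeling (space X) q) (LY : labeling (space Y) q),
    [/\ stabilization LX, stabilization LY &
        isomorphic (relabel LX) (relabel LY)].

(* Without closedness, GHst X Y = 0 does not imply stable equivalence: [0, 1]
   labeled by ([0, 1], ]0, 1]) and [0, 1] labeled by ([0, 1], [0, 1]) are at
   distance 0, since GHst only sees the closures of the labels. *)
Definition closed_labels k (X : labeled_metric_space R k) : Prop :=
  forall i, closed (labels X i).

End GH.

(* Main.v *)
Require Import Defs.
From mathcomp Require Import all_boot all_order all_algebra.
From mathcomp Require Import all_classical all_reals all_analysis.
From mathcomp Require Import lra.

(** The maximum of the distortions [dis (C i) (C j)] is the distortion of the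
    union of the [C i]. Hence, up to strict versus large inequalities,
    [GHst X Y <= e] means that there is a single relation [D] of distortion at
    most [2 e] such that every label of either space is matched by [D] with
    some label of the other; the repetitions allowed by stabilization absorb
    the multivalued matching of labels. Symmetry and the triangle inequality
    follow by inverting and composing relations. If [GHst X Y = 0], take such
    relations [D n] of distortion tending to [0] and their limit along an
    ultrafilter: its distortion is [0], so it is the graph of an isometry, and
    compactness of the closed labels lets matched labels stay matched in the
    limit. *)

Set Implicit Arguments.
Unset Strict Implicit.
Unset Printing Implicit Defensive.

(* [Defs] is imported again because [vector.space] shadows its [space]. *)
Import Defs Order.TTheory GRing.Theory Num.Theory.

Local Open Scope classical_set_scope.
Local Open Scope ring_scope.

(** * Matching of sets by a relation *)

Definition matches (S T : Type) (D : S -> T -> Prop) (A : set S) (B : set T) :=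
  (forall x, A x -> exists2 y, B y & D x y) /\
  (forall y, B y -> exists2 x, A x & D x y).

Lemma matches_flip (S T : Type) (D : S -> T -> Prop) (A : set S) (B : set T) :
  matches D A B -> matches (fun y x => D x y) B A.
Proof. by case. Qed.

Lemma matches_comp (S T U : Type) (D : S -> T -> Prop) (E : T -> U -> Prop)
    (A : set S) (B : set T) (C : set U) :
  matches D A B -> matches E B C ->
  matches (fun x z => exists2 y, D x y & E y z) A C.
Proof.
move=> [DA DB] [EB EC]; split=> [x /DA[y /EB[z Cz Eyz] Dxy]|z /EC[y + Eyz]].
  by exists z => //; exists y.
by move=> /DB[x Ax Dxy]; exists x => //; exists y.
Qed.

(** * Distortion of relations, and compactness in metric spaces *)

Section distortion.
Context {R : realType}.
Implicit Types S T U : metricType R.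

Definition distortion_le S T (D : S -> T -> Prop) (e : R) :=
  forall x y x' y', D x y -> D x' y' -> `|mdist x x' - mdist y y'| <= e.

Lemma distortion_le_flip S T (D : S -> T -> Prop) e :
  distortion_le D e -> distortion_le (fun y x => D x y) e.
Proof. by move=> De y x y' x' xy xy'; rewrite distrC; exact: De. Qed.

Lemma distortion_le_comp S T U (D : S -> T -> Prop) (E : T -> U -> Prop) e f :
  distortion_le D e -> distortion_le E f ->
  distortion_le (fun x z => exists2 y, D x y & E y z) (e + f).
Proof.
move=> De Ef x z x' z' [y xy yz] [y' xy' yz'].
rewrite (le_trans (ler_distD (mdist y y') _ _))// lerD//; first exact: De.
exact: Ef.
Qed.

Lemma compact_seq_cluster T (A : set T) (u : nat -> T) (F : set_system nat) :
  ProperFilter F -> compact A -> F [set n | A (u n)] ->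
  exists2 p, A p & forall e, 0 < e -> forall B, F B ->
    exists2 n, B n & mdist p (u n) < e.
Proof.
move=> PF cA FA.
have [p [Ap clp]] := cA (u @ F) _ FA.
exists p => // e e0 B FB.
have FuB : F (u @^-1` (u @` B)) by apply: filterS FB => n Bn; exists n.
have [_ [[n Bn <-] pun]] := clp _ _ FuB (nbhsx_ballx p e e0).
by exists n => //; rewrite ballEmdist in pun.
Qed.

(** Otherwise some sequence escapes from a base point [x0], although it has a cluster point. *)
Lemma compact_mdist_bounded T :
  compact [set: T] -> exists M, forall x y : T, mdist x y <= M.
Proof.
move=> cT; have [[x0]|noT] := pselect (exists x : T, True); last first.
  by exists 0 => x; case: noT; exists x.
suff [M x0M] : exists M, forall x : T, mdist x0 x <= M.
  exists (M + M) => x y.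
  rewrite (le_trans (metric_triangle _ x0 _))// metric_sym lerD//.
apply: contrapT => unb.
have /choice[u ux0] : forall n : nat, exists x : T, n%:R < mdist x0 x.
  move=> n; apply: contrapT => nx; apply: unb; exists n%:R => x.
  by rewrite leNgt; apply/negP => xn; apply: nx; exists x.
have [p _ /(_ 1 ltr01)] := @compact_seq_cluster T _ u \oo _ cT filterT.
(* An index [n] above [mdist x0 p + 1] with [u n] within [1] of [p] contradicts
   [n < mdist x0 (u n)]. *)
case/(_ _ (nbhs_infty_gt (Num.truncn (mdist x0 p + 1)))) => n /=.
rewrite truncn_lt_nat ?addr_ge0 ?mdist_ge0// => pn pun.
have := ux0 n; have := metric_triangle x0 p (u n); lra.
Qed.

End distortion.

(** With choice functions [f] and [g] for the two hypotheses, the [k + l] pairs [(i, f i)] and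
    [(g j, j)] satisfy [P] and reach every index on both sides. *)
Lemma exists2_surj_cover (k l : nat) (P : 'I_k -> 'I_l -> Prop) :
  (forall i, exists j, P i j) -> (forall j, exists i, P i j) ->
  exists q (rho : 'I_q -> 'I_k) (sigma : 'I_q -> 'I_l),
    [/\ set_surj [set: 'I_q] [set: 'I_k] rho,
        set_surj [set: 'I_q] [set: 'I_l] sigma &
        forall a, P (rho a) (sigma a)].
Proof.
move=> /choice[f Pf] /choice[g Pg]; exists (k + l)%N.
exists (fun a => match fintype.split a with inl i => i | inr j => g j end).
exists (fun a => match fintype.split a with inl i => f i | inr j => j end).
split=> [i _|j _|a]; last by case: (fintype.split a).
- by exists (unsplit (inl i)); rewrite ?unsplitK.
- by exists (unsplit (inr j)); rewrite ?unsplitK.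
Qed.

(** * From stabilizations and correspondences to a single relation *)

Section GHst_theory.
Context {R : realType}.

Lemma stabilization_of_surj k q (X : labeled_metric_space R k)
    (rho : 'I_q -> 'I_k) : set_surj [set: 'I_q] [set: 'I_k] rho ->
  exists2 L : labeling (space X) q, stabilization L &
    forall a, L a = labels X (rho a).
Proof.
move=> rho_surj.
(* A section of [rho] is injective. *)
have kq : (k <= q)%N.
  have /choice[s sK] : forall i, exists a, rho a = i.
    by move=> i; have [a _ ai] := rho_surj i I; exists a.
  by have := leq_card s (can_inj sK); rewrite !card_ord.
have cov : \bigcup_a labels X (rho a) = [set: space X].
  apply/seteqP; split=> // x _.
  have : [set: space X] x by [].
  rewrite -(label_cover (labels X)) => -[i _ Xix].
  by have [a _ ai] := rho_surj i I; exists a; rewrite // ai.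
have q0 := leq_trans (label_pos (labels X)) kq.
exists (Labeling q0 (fun a => label_nonempty (labels X) (rho a)) cov) => //.
by split=> //; exists rho.
Qed.

Definition matched_labels k l (X : labeled_metric_space R k)
    (Y : labeled_metric_space R l) (D : space X -> space Y -> Prop) :=
  (forall i, exists j, matches D (labels X i) (labels Y j)) /\
  (forall j, exists i, matches D (labels X i) (labels Y j)).

(** The factor [2] undoes the [2^-1] in [GH], so that [e] bounds the distance itself. *)
Definition GHst_within k l (X : labeled_metric_space R k)
    (Y : labeled_metric_space R l) (e : R) :=
  exists2 D : space X -> space Y -> Prop,
    distortion_le D (2 * e) & matched_labels D.

Section two_spaces.
Context {k l : nat} (X : labeled_metric_space R k)
  (Y : labeled_metric_space R l).

(** Enumerating the matched pairs of labels gives two stabilizations; restricting [D] to each pair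
    gives correspondences, whose mutual distortions are all bounded by that of [D]. *)
Lemma GHst_within_le e : GHst_within X Y e -> (GHst X Y <= e%:E)%E.
Proof.
move=> [D De [DX DY]].
have [q [rho [sigma [rho_surj sigma_surj Dmatch]]]] := exists2_surj_cover DX DY.
have [LX LXst LXE] := stabilization_of_surj X rho_surj.
have [LY LYst LYE] := stabilization_of_surj Y sigma_surj.
apply: ge_ereal_inf; exists (GH (relabel LX) (relabel LY)).
  by exists q, LX, LY.
rewrite /GH lee_pdivrMl// -EFinM; apply: ge_ereal_inf; eexists.
  exists (fun a p => [/\ LX a p.1, LY a p.2 & D p.1 p.2]) => //= a.
  have [DXa DYa] := Dmatch a; rewrite -LXE -LYE in DXa DYa.
  split; first by move=> p [].
  - apply/seteqP; split=> [_ [p [? _ _] <-]//|x /[dup] LXx /DXa[y LYy xy]].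
    by exists (x, y).
  - apply/seteqP; split=> [_ [p [_ ? _] <-]//|y /[dup] LYy /DYa[x LXx xy]].
    by exists (x, y).
apply/bigmax_leP; split=> [|a _]; first exact: leNye.
apply/bigmax_leP; split=> [|b _]; first exact: leNye.
apply: ge_ereal_sup => _ [p [_ _ Dp] [p' [_ _ Dp'] <-]].
by rewrite lee_fin; exact: De.
Qed.

(** The strict inequality provides stabilizations and correspondences [C] without the infima being
    attained; the relation is the union of the [C b]. *)
Lemma GHst_lt_within e : (GHst X Y < e%:E)%E -> GHst_within X Y e.
Proof.
case/ereal_inf_lt => _ [q [LX [LY [[_ [rho [rho_surj LXE]]]
  [_ [sigma [sigma_surj LYE]]] ->]]]].
rewrite /GH lte_pdivrMl// -EFinM => /ereal_inf_lt[_ [C Ccorr <-] Ce].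
have Dmatch a : matches (fun x y => exists b, C b (x, y))
    (labels X (rho a)) (labels Y (sigma a)).
  rewrite -LXE -LYE; have [Csub /seteqP[_ CX] /seteqP[_ CY]] := Ccorr a.
  split=> [x /CX[[x' y] Cxy /= <-]|y /CY[[x y'] Cxy /= <-]].
  - by exists y; [have [] := Csub _ Cxy|exists a].
  - by exists x; [have [] := Csub _ Cxy|exists a].
exists (fun x y => exists b, C b (x, y)); last split=> [i|j].
(* Pairs from [C b] and [C b'] are controlled by [dis (C b) (C b')], one entry of the maximum. *)
- move=> x y x' y' [b xy] [b' xy']; rewrite -lee_fin.
  apply: le_trans (ltW Ce).
  apply: le_trans (le_bigmax _ _ b); apply: le_trans (le_bigmax _ _ b').
  by apply: ereal_sup_ubound; exists (x, y) => //; exists (x', y').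
- by have [a _ <-] := rho_surj i I; exists (sigma a).
- by have [a _ <-] := sigma_surj j I; exists (rho a).
Qed.

Lemma GHst_ge0 : (0 <= GHst X Y)%E.
Proof.
apply: le_ereal_inf_tmp => _ [q [LX [LY [_ _ ->]]]].
rewrite mule_ge0 ?lee_fin ?invr_ge0//; apply: le_ereal_inf_tmp => _ [C CP <-].
(* Since there is a label and it is nonempty, [C a] contains some [p], and comparing [p] with itself
   keeps the maximum from being [-oo]. *)
pose a := Ordinal (label_pos LX).
have [x LXx] := label_nonempty LX a.
have [_ /seteqP[_ /(_ _ LXx)[p Cp _]] _] := CP a.
apply: le_trans (le_bigmax _ _ a); apply: le_trans (le_bigmax _ _ a).
apply: le_trans (ereal_sup_ubound _); last by exists p => //; exists p.
by rewrite lee_fin.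
Qed.

(** The total relation matches any two nonempty labels, and its distortion is at most the sum of
    bounds on the diameters. *)
Lemma GHst_within_exists : exists e, GHst_within X Y e.
Proof.
have [M XM] := compact_mdist_bounded (@space_compact R k X).
have [N YN] := compact_mdist_bounded (@space_compact R l Y).
have total i j : matches (fun _ _ => True) (labels X i) (labels Y j).
  have [x0 Xx0] := label_nonempty (labels X) i.
  have [y0 Yy0] := label_nonempty (labels Y) j.
  by split=> [x _|y _]; [exists y0|exists x0].
exists ((M + N) / 2), (fun _ _ => True); last split=> [i|j].
- move=> x y x' y' _ _; rewrite mulrC divfK//.
  apply: le_trans (ler_normB _ _) _.
  by rewrite !ger0_norm ?mdist_ge0// lerD.
- by exists (Ordinal (label_pos (labels Y))).
- by exists (Ordinal (label_pos (labels X))).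
Qed.

Lemma GHst_lty : (GHst X Y < +oo)%E.
Proof.
have [e /GHst_within_le XYe] := GHst_within_exists.
exact: le_lt_trans XYe (ltry _).
Qed.

Lemma GHst_fin_num : GHst X Y \is a fin_num.
Proof. by rewrite ge0_fin_numE ?GHst_ge0 ?GHst_lty. Qed.

(** The slack [e] supplies the strict inequality required by [GHst_lt_within]. *)
Lemma GHst_within_addgt0 e : 0 < e -> GHst_within X Y (fine (GHst X Y) + e).
Proof.
move=> e0; apply: GHst_lt_within.
by rewrite -[ltLHS](fineK GHst_fin_num) lte_fin ltrDl.
Qed.

Lemma GHst_within_sym e : GHst_within X Y e -> GHst_within Y X e.
Proof.
move=> [D De [DX DY]]; exists (fun y x => D x y).
  exact: distortion_le_flip.
split=> [j|i].
- by have [i /matches_flip ij] := DY j; exists i.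
- by have [j /matches_flip ij] := DX i; exists j.
Qed.

Lemma stably_equivalent_within0 : stably_equivalent X Y -> GHst_within X Y 0.
Proof.
move=> [q [LX [LY [[_ [rho [rho_surj LXE]]] [_ [sigma [sigma_surj LYE]]]
  [phi [_ phi_iso phiL]]]]]].
have Dmatch a : matches (fun x y => phi x = y)
    (labels X (rho a)) (labels Y (sigma a)).
  rewrite -LXE -LYE -(phiL a); split=> [x LXx|_ [x LXx <-]]; last by exists x.
  by exists (phi x) => //; exists x.
exists (fun x y => phi x = y); last split=> [i|j].
- by move=> x _ x' _ <- <-; rewrite phi_iso subrr normr0 mulr0.
- by have [a _ <-] := rho_surj i I; exists (sigma a).
- by have [a _ <-] := sigma_surj j I; exists (rho a).
Qed.

(** Zero distortion makes [D] preserve distances, hence single-valued and injective: it is the graph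
    of an isometry. *)
Lemma within0_stably_equivalent : GHst_within X Y 0 -> stably_equivalent X Y.
Proof.
move=> [D D0 [DX DY]].
have {}D0 x y x' y' : D x y -> D x' y' -> mdist x x' = mdist y y'.
  move=> xy xy'; have := D0 _ _ _ _ xy xy'.
  by rewrite mulr0 normr_le0 subr_eq0 => /eqP.
have Dfun x y y' : D x y -> D x y' -> y = y'.
  by move=> xy xy'; apply: mdist_positivity; rewrite -(D0 _ _ _ _ xy xy') mdistxx.
have Dinj x x' y : D x y -> D x' y -> x = x'.
  by move=> xy xy'; apply: mdist_positivity; rewrite (D0 _ _ _ _ xy xy') mdistxx.
(* [D] is total because the labels cover the space and each is matched. *)
have /choice[phi Dphi] x : exists y, D x y.
  have : [set: space X] x by [].
  rewrite -(label_cover (labels X)) => -[i _ Xix].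
  by have [j [/(_ _ Xix)[y _ xy] _]] := DX i; exists y.
have /choice[psi Dpsi] y : exists x, D x y.
  have : [set: space Y] y by [].
  rewrite -(label_cover (labels Y)) => -[j _ Yjy].
  by have [i [_ /(_ _ Yjy)[x _ xy]]] := DY j; exists x.
have [q [rho [sigma [rho_surj sigma_surj Dmatch]]]] := exists2_surj_cover DX DY.
have [LX LXst LXE] := stabilization_of_surj X rho_surj.
have [LY LYst LYE] := stabilization_of_surj Y sigma_surj.
exists q, LX, LY; split=> //; exists phi; split=> [||a].
- exists psi => [x|y]; first exact: Dinj (Dpsi _) (Dphi _).
  exact: Dfun (Dphi _) (Dpsi _).
- by move=> x x'; rewrite (D0 _ _ _ _ (Dphi x) (Dphi x')).
- have [DXa DYa] := Dmatch a; rewrite /= LXE LYE.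
  apply/seteqP; split=> [_ [x /DXa[y Yy xy] <-]|y /DYa[x Xx xy]].
  + by rewrite (Dfun _ _ _ (Dphi x) xy).
  + by exists x => //; exact: Dfun (Dphi x) xy.
Qed.

End two_spaces.

(** * Symmetry and the triangle inequality *)

Lemma GHst_within_trans k l m (X : labeled_metric_space R k)
    (Y : labeled_metric_space R l) (Z : labeled_metric_space R m) e f :
  GHst_within X Y e -> GHst_within Y Z f -> GHst_within X Z (e + f).
Proof.
move=> [D De [DX DY]] [E Ef [EY EZ]].
exists (fun x z => exists2 y, D x y & E y z).
  by rewrite mulrDr; exact: distortion_le_comp.
split=> [i|h].
- have [j ij] := DX i; have [h jh] := EY j.
  by exists h; exact: matches_comp ij jh.
- have [j jh] := EZ h; have [i ij] := DY j.
  by exists i; exact: matches_comp ij jh.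
Qed.

Lemma GHst_sym k l (X : labeled_metric_space R k)
    (Y : labeled_metric_space R l) : GHst X Y = GHst Y X.
Proof.
suff le_sym k' l' (X' : labeled_metric_space R k')
    (Y' : labeled_metric_space R l') : (GHst X' Y' <= GHst Y' X')%E.
  by apply/eqP; rewrite eq_le !le_sym.
apply/lee_addgt0Pr => e e0; rewrite -(fineK (GHst_fin_num Y' X')) -EFinD.
exact/GHst_within_le/GHst_within_sym/GHst_within_addgt0.
Qed.

Lemma GHst_triangle k l m (X : labeled_metric_space R k)
    (Y : labeled_metric_space R l) (Z : labeled_metric_space R m) :
  (GHst X Z <= GHst X Y + GHst Y Z)%E.
Proof.
apply/lee_addgt0Pr => e e0; have e20 : 0 < e / 2 by rewrite divr_gt0.
have := GHst_within_trans (GHst_within_addgt0 X Y e20)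
  (GHst_within_addgt0 Y Z e20).
rewrite addrACA -splitr => /GHst_within_le.
by rewrite !EFinD !fineK ?GHst_fin_num.
Qed.

End GHst_theory.

(** * Limits of relations along an ultrafilter *)

Section ultralimit.
Context {R : realType}.
Implicit Types S T : metricType R.

Definition limit_rel S T (F : set_system nat) (D : nat -> S -> T -> Prop) x y :=
  forall e : R, 0 < e ->
    F [set n | exists x' y', [/\ D n x' y', mdist x x' < e & mdist y y' < e]].

Lemma limit_rel_flip S T F (D : nat -> S -> T -> Prop) x y :
  Filter F ->
  limit_rel F D x y -> limit_rel F (fun n y x => D n x y) y x.
Proof.
move=> FF xy e e0; apply: filterS (xy e e0) => n [x' [y' [xy' xx' yy']]].
by exists y', x'.
Qed.

Lemma limit_rel_distortion S T F (D : nat -> S -> T -> Prop) (d : nat -> R) :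
  ProperFilter F -> (forall e, 0 < e -> F [set n | d n < e]) ->
  (forall n, distortion_le (D n) (d n)) ->
  distortion_le (limit_rel F D) 0.
Proof.
move=> PF d0 Dd x y x' y' xy xy'; apply/ler_addgt0Pr => e e0; rewrite add0r.
(* Moving the four points [x], [x'], [y], [y'] to the approximating pairs costs four times [e / 5],
   and [d n] costs the fifth. *)
have e50 : 0 < e / 5 by rewrite divr_gt0.
case: (filter_ex (filterI (filterI (xy _ e50) (xy' _ e50)) (d0 _ e50))).
move=> n [[[a [b [ab xa yb]]] [a' [b' [ab' xa' yb']]]] /= dn].
have := Dd _ _ _ _ _ ab ab'; rewrite !ler_norml => /andP[].
have := metric_triangle x a x'; have := metric_triangle a a' x'.
have := metric_triangle a x a'; have := metric_triangle x x' a'.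
have := metric_triangle y b y'; have := metric_triangle b b' y'.
have := metric_triangle b y b'; have := metric_triangle y y' b'.
rewrite (metric_sym a x) (metric_sym a' x') (metric_sym b y) (metric_sym b' y').
move=> *; apply/andP; split; lra.
Qed.

(** Partners [u n] of the fixed [x] cluster at some [y] in the compact [B]; as [F] is ultra,
    clustering at [y] amounts to converging to it. *)
Lemma limit_rel_total S T F (D : nat -> S -> T -> Prop) (A : set S)
    (B : set T) : UltraFilter F -> compact B ->
  F [set n | forall x, A x -> exists2 y, B y & D n x y] ->
  forall x, A x -> exists2 y, B y & limit_rel F D x y.
Proof.
move=> UF cB FAB x Ax.
have FB : F [set n | exists2 y, B y & D n x y].
  by apply: filterS FAB => n; exact.
have [n0 [y0 By0 _]] := filter_ex FB.
(* [u] must be defined at every [n]; [y0] is the value where [x] has no partner. *)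
have /choice[u uP] n :
    exists y, (exists2 y, B y & D n x y) -> B y /\ D n x y.
  have [[y By xy]|nB] := pselect (exists2 y, B y & D n x y); first by exists y.
  by exists y0.
have [|y By ycl] := @compact_seq_cluster R T B u F _ cB.
  by apply: filterS FB => n /uP[].
exists y => // e e0; have FD : F [set n | D n x (u n)].
  by apply: filterS FB => n /uP[].
(* If the complement were in [F], clustering would give an [n] in it with [u n] close to [y]. *)
have [Fy|Fny] := in_ultra_setVsetC [set n | mdist y (u n) < e] UF.
  apply: filterS (filterI FD Fy) => n [xun yun].
  by exists x, (u n); split=> //; rewrite mdistxx.
by have [n] := ycl e e0 _ Fny.
Qed.

Lemma limit_rel_matches S T F (D : nat -> S -> T -> Prop) (A : set S)
    (B : set T) : UltraFilter F -> compact A -> compact B ->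
  F [set n | matches (D n) A B] -> matches (limit_rel F D) A B.
Proof.
move=> UF cA cB FM; split=> [x Ax|y By].
- by apply: (limit_rel_total UF cB _ Ax); apply: filterS FM => n [].
- have [|x Ax yx] :=
    @limit_rel_total _ _ F (fun n y x => D n x y) B A UF cA _ y By.
    by apply: filterS FM => n [].
  by exists x => //; exact: limit_rel_flip yx.
Qed.

(** Pigeonhole: otherwise [F] contains all the finitely many complements, whose intersection is
    empty. *)
Lemma ultra_exists_fin (N : Type) (F : set_system N) (I : finType)
    (P : N -> I -> Prop) : UltraFilter F ->
  (forall n, exists i, P n i) -> exists i, F [set n | P n i].
Proof.
move=> UF exP; apply: contrapT => nP.
have /filter_forall/filter_ex[n nPn] : forall i, F (~` [set n | P n i]).
  move=> i; have [FP|//] := in_ultra_setVsetC [set n | P n i] UF.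
  by case: nP; exists i.
by have [i /nPn] := exP n.
Qed.

End ultralimit.

(** Closed labels are compact, so matchings pass to the limit. The label matched with a given one
    may vary with [n], but is constant on a set of [F]. *)
Lemma GHst_eq0_within0 (R : realType) k l (X : labeled_metric_space R k)
    (Y : labeled_metric_space R l) :
  closed_labels X -> closed_labels Y -> GHst X Y = 0%E -> GHst_within X Y 0.
Proof.
move=> clX clY XY0.
have cX i : compact (labels X i) := subclosed_compact (clX i)
  (@space_compact R k X) (@subsetT _ _).
have cY j : compact (labels Y j) := subclosed_compact (clY j)
  (@space_compact R l Y) (@subsetT _ _).
have /choice[D DP] n : exists D : space X -> space Y -> Prop,
    distortion_le D (2 * n.+1%:R^-1) /\ matched_labels D.
  have [|D De DM] := @GHst_lt_within R k l X Y n.+1%:R^-1; last by exists D.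
  by rewrite XY0 lte_fin invr_gt0.
(* [F] refines [\oo], so the distortion bounds [2 / (n + 1)] tend to [0] along it. *)
have [F [UF ooF]] := @ultraFilterLemma nat \oo _.
exists (limit_rel F D); last split=> [i|j].
- rewrite mulr0; apply: (@limit_rel_distortion _ _ _ F D _ _ _ (fun n => (DP n).1)).
  move=> e e0; apply: ooF.
  have e20 : 0 < e / 2 by rewrite divr_gt0.
  apply: filterS (near_infty_natSinv_lt (PosNum e20)) => n /=.
  by rewrite ltr_pdivlMr// mulrC.
- have [j Fj] := ultra_exists_fin UF (fun n => (DP n).2.1 i).
  by exists j; exact: limit_rel_matches.
- have [i Fi] := ultra_exists_fin UF (fun n => (DP n).2.2 j).
  by exists i; exact: limit_rel_matches.
Qed.

Theorem theorem2p5p8 (R : realType) (k l m : nat)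
    (X : labeled_metric_space R k) (Y : labeled_metric_space R l)
    (Z : labeled_metric_space R m) :
  ((0 <= GHst X Y)%E /\ (GHst X Y < +oo)%E) /\
  GHst X Y = GHst Y X /\
  (GHst X Z <= GHst X Y + GHst Y Z)%E /\
  (stably_equivalent X Y -> GHst X Y = 0%E) /\
  (closed_labels X -> closed_labels Y ->
     (GHst X Y = 0%E <-> stably_equivalent X Y)).
Proof.
have eq0 : stably_equivalent X Y -> GHst X Y = 0%E.
  move=> /stably_equivalent_within0/GHst_within_le XY0.
  by apply/eqP; rewrite eq_le XY0 GHst_ge0.
split; first by split; [exact: GHst_ge0|exact: GHst_lty].
split; first exact: GHst_sym.
split; first exact: GHst_triangle.
split=> // clX clY; split=> // XY0.
exact/within0_stably_equivalent/GHst_eq0_within0.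
Qed.
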